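(* Let $k\ge 2$ and $n\ge 1$ be integers and let $T_k^n$ be the perfect $k$-ary tree of depth $n$. The frugal distinguishing number of $T_k^n$ is $$\operatorname{Fdist}(T_k^n)=\begin{cases}k & \text{if } n=1,\\ k+1 & \text{if } n=2,\\ k+2 & \text{if } n\ge 3.\end{cases}$$
   Context: All graphs are finite and simple. For $k\ge 2$, $n\ge 1$, the perfect $k$-ary tree of depth $n$, denoted $T_k^n$, is the connected acyclic graph with $k^n$ leaves in which one vertex (the root) has degree $k$ and is at distance $n$ from every leaf, and all other internal (non-leaf) vertices have degree $k+1$. A coloring of the vertices of a graph $G$ with $d$ colors (a map from $V(G)$ to a set of $d$ colors, not required to use every color) is $d$-distinguishing if the only automorphism of $G$ preserving the color classes (i.e. mapping each color class to itself) is the trivial one. The distinguishing number $\operatorname{Dist}(G)$ is the smallest $d$ for which $G$ has a $d$-distinguishing coloring. For $d\ge \operatorname{Dist}(G)$, the $d$-paint cost $\rho^d(G)$ is the minimum size of the complement of a color class over all $d$-distinguishing colorings of $G$. A set $S\subseteq V(G)$ is a fixing set for $G$ if the only automorphism of $G$ that fixes every element of $S$ is the trivial one; the fixing number $\operatorname{Fix}(G)$ is the smallest cardinality of a fixing set. The frugal distinguishing number (or frugal number) $\operatorname{Fdist}(G)$ is the smallest $d$ for which $\rho^d(G)=\operatorname{Fix}(G)$. *)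

(* Defs.v *)
From HB Require Import structures.
From mathcomp Require Import all_boot all_fingroup.

Set Implicit Arguments.
Unset Strict Implicit.
Unset Printing Implicit Defensive.

Record sgraph := SGraph {
  vertex :> finType;
  adj : rel vertex;
  adj_sym : symmetric adj;
  adj_irr : irreflexive adj
}.

Section Trees.
Variable G : sgraph.

Definition degree (x : G) : nat := #|[set y | adj x y]|.
Definition leaf (x : G) : bool := degree x == 1.
Definition connected : Prop := forall x y : G, connect (@adj G) x y.

(* [ucycle] accepts the walk x, y, x along a single edge, which has size 2. *)
Definition acyclic : Prop := forall c : seq G, ucycle (@adj G) c -> size c < 3.

Definition walk_length (x y : G) (m : nat) : Prop :=
  exists p : seq G, [/\ path (@adj G) x p, last x p = y & size p = m].

Definition at_distance (x y : G) (m : nat) : Prop :=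
  walk_length x y m /\ (forall m', walk_length x y m' -> m <= m').

Definition perfect_tree (k n : nat) : Prop :=
  [/\ connected, acyclic, #|[set x : G | leaf x]| = k ^ n &
   exists r : G,
     [/\ degree r = k,
         forall x : G, leaf x -> at_distance r x n &
         forall x : G, ~~ leaf x -> x != r -> degree x = k.+1]].

End Trees.

Section Distinguishing.
Variable G : sgraph.

Definition automorphism (f : {perm G}) : bool :=
  [forall x, forall y, adj (f x) (f y) == adj x y].

Definition distinguishing (d : nat) (c : {ffun G -> 'I_d}) : bool :=
  [forall f : {perm G},
     automorphism f ==> [forall x, c (f x) == c x] ==> (f == 1%g)].

Definition distinguishable (d : nat) : bool :=
  [exists c : {ffun G -> 'I_d}, distinguishing c].

Lemma distinguishingP d (c : {ffun G -> 'I_d}) :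
  reflect (forall f : {perm G}, automorphism f -> (forall x, c (f x) = c x) ->
             f = 1%g)
          (distinguishing c).
Proof.
apply: (iffP forallP) => [H f fA fc | H f].
  by apply/eqP; move: (H f); rewrite fA implyTb => /implyP; apply; apply/forallP => x; rewrite fc.
apply/implyP => fA; apply/implyP => /forallP fc; apply/eqP.
by apply: H => // x; apply/eqP.
Qed.

Lemma distinguishable_ex : exists d, distinguishable d.
Proof.
exists #|G|; apply/existsP; exists [ffun x => enum_rank x].
apply/distinguishingP => f _ fc; apply/permP => x.
by move: (fc x); rewrite !ffunE perm1 => /enum_rank_inj.
Qed.

Definition Dist : nat := ex_minn distinguishable_ex.

Definition color_class (d : nat) (c : {ffun G -> 'I_d}) (i : 'I_d) : {set G} :=
  [set x | c x == i].

(* The default value [#|G|] bounds every size in the range, so it never lowers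
   the minimum; see [paint_cost_le] and [paint_cost_attained].  The value is
   meaningful for [Dist <= d]. *)
Definition paint_cost (d : nat) : nat :=
  \big[minn/#|G|]_(c : {ffun G -> 'I_d} | distinguishing c)
     \big[minn/#|G|]_(i < d) #|~: color_class c i|.

Definition fixing (S : {set G}) : bool :=
  [forall f : {perm G},
     automorphism f ==> [forall x in S, f x == x] ==> (f == 1%g)].

Definition Fix : nat := #|[arg min_(S < [set: G] | fixing S) #|S| ]|.

Lemma fixingP (S : {set G}) :
  reflect (forall f : {perm G}, automorphism f -> {in S, forall x, f x = x} ->
             f = 1%g)
          (fixing S).
Proof.
apply: (iffP forallP) => [H f fA fS | H f].
  apply/eqP; move: (H f); rewrite fA implyTb => /implyP; apply.
  by apply/forall_inP => x /fS ->.
apply/implyP => fA; apply/implyP => /forall_inP fS; apply/eqP.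
by apply: H => // x xS; apply/eqP/fS.
Qed.

Lemma fixing_setT : fixing [set: G].
Proof.
by apply/fixingP => f _ fT; apply/permP => x; rewrite perm1 fT ?inE.
Qed.

Lemma Fix_le (S : {set G}) : fixing S -> Fix <= #|S|.
Proof. by rewrite /Fix; case: arg_minnP => [|A _ AP]; [exact: fixing_setT | exact: AP]. Qed.

Lemma Fix_attained : exists2 S : {set G}, fixing S & #|S| = Fix.
Proof.
by rewrite /Fix; case: arg_minnP => [|A fA _]; [exact: fixing_setT | exists A].
Qed.

Lemma Dist_leP d : reflect (exists c : {ffun G -> 'I_d}, distinguishing c) (Dist <= d).
Proof.
apply: (iffP idP); rewrite /Dist; case: ex_minnP => m /existsP[c0 c0D] mP.
  move=> md; exists [ffun x => widen_ord md (c0 x)].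
  apply/distinguishingP => f fA fc; move/distinguishingP: c0D; apply=> // x.
  by move: (fc x); rewrite !ffunE => /(congr1 val) /= /val_inj.
by case=> c cD; apply: mP; apply/existsP; exists c.
Qed.

Lemma bigminn_le (I : finType) (P : pred I) (F : I -> nat) N i :
  P i -> \big[minn/N]_(j | P j) F j <= F i.
Proof.
move=> Pi; have: i \in index_enum I by exact: mem_index_enum.
elim: (index_enum I) => // j s IH; rewrite in_cons big_cons => /predU1P[<-|/IH le].
  by rewrite Pi geq_minl.
by case: ifP => // _; apply: leq_trans le; rewrite geq_minr.
Qed.

Lemma bigminn_ind (I : finType) (P : pred I) (F : I -> nat) N (K : nat -> Prop) :
  K N -> (forall i, P i -> K (F i)) -> K (\big[minn/N]_(j | P j) F j).
Proof. by move=> KN KF; apply: big_ind => // x y Kx Ky; rewrite /minn; case: ifP. Qed.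

Lemma paint_cost_le d (c : {ffun G -> 'I_d}) (i : 'I_d) :
  distinguishing c -> paint_cost d <= #|~: color_class c i|.
Proof.
move=> cD; apply: (@leq_trans (\big[minn/#|G|]_(i < d) #|~: color_class c i|)).
  exact: bigminn_le.
exact: bigminn_le.
Qed.

Lemma paint_cost_attained d : 0 < #|G| -> Dist <= d ->
  exists c : {ffun G -> 'I_d}, exists i : 'I_d,
    distinguishing c /\ #|~: color_class c i| = paint_cost d.
Proof.
move=> G0 /Dist_leP[c cD]; have [x _] := card_gt0P G0.
pose K m := m = #|G| \/ exists c : {ffun G -> 'I_d}, exists i : 'I_d,
    distinguishing c /\ #|~: color_class c i| = m.
have: K (paint_cost d).
  apply: bigminn_ind => [|c' c'D]; first by left.
  by apply: bigminn_ind => [|i _]; [left | right; exists c', i].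
case=> // E; have := paint_cost_le (c x) cD.
rewrite E leqNgt -cardsT => /negP[].
by apply/proper_card/properP; split; [exact: subsetT | exists x; rewrite !inE ?eqxx].
Qed.

Lemma Fix_le_paint_cost d : Fix <= paint_cost d.
Proof.
have FG : Fix <= #|G| by rewrite -cardsT Fix_le // fixing_setT.
apply: (bigminn_ind (K := leq Fix)) => // c cD.
apply: (bigminn_ind (K := leq Fix)) => // i _.
apply: Fix_le; apply/fixingP => f fA fS; move/distinguishingP: cD; apply=> // x.
have [xi|] := boolP (x \in ~: color_class c i); first by rewrite fS.
rewrite !inE negbK => /eqP cx.
have [fxi|] := boolP (f x \in ~: color_class c i).
  by congr (c _); apply: (@perm_inj _ f); rewrite fS.
by rewrite !inE negbK cx => /eqP.
Qed.

Lemma Fdist_ex : exists d, (Dist <= d) && (paint_cost d == Fix).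
Proof.
have [S SF SC] := Fix_attained; exists #|S|.+1.
pose c : {ffun G -> 'I_(#|S|.+1)} := [ffun x => inord (index x (enum S))].
have idx x : index x (enum S) < #|S|.+1 by rewrite ltnS cardE index_size.
have cD : distinguishing c.
  apply/distinguishingP => f fA fc; move/fixingP: SF; apply=> // x xS.
  move: (fc x); rewrite !ffunE => /(congr1 val); rewrite /= !inordK // => E.
  have xe : x \in enum S by rewrite mem_enum.
  have fxe : f x \in enum S by rewrite -index_mem E index_mem.
  by rewrite -(nth_index x fxe) E nth_index.
apply/andP; split; first by apply/Dist_leP; exists c.
rewrite eqn_leq Fix_le_paint_cost andbT -SC.
apply: leq_trans (paint_cost_le ord_max cD) _; apply: subset_leq_card.
apply/subsetP => x; rewrite !inE ffunE; apply: contraR => xS.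
by apply/eqP/val_inj; rewrite /= inordK // memNindex ?mem_enum // cardE.
Qed.

Definition Fdist : nat := ex_minn Fdist_ex.

End Distinguishing.

(* Main.v *)
Require Import Defs.
From mathcomp Require Import all_boot.
From mathcomp Require Import all_fingroup zify.

Set Implicit Arguments.
Unset Strict Implicit.
Unset Printing Implicit Defensive.

(* Write a vertex as the list of child indices leading to it from the root.  Any
   family of permutations of the children, one at each vertex, gives an automorphism,
   so two siblings whose subtrees are isomorphic as colored trees can be swapped.
   Call the vertices just above the leaves cherries.  Sibling leaves swap when neither
   is in a fixing set, so the fixing number is N = k^(n-1) (k-1): all leaves but one in
   each cherry.  In a distinguishing coloring whose null class has a complement of size
   N, each cherry shows one null leaf and k-1 distinct other colors, and isomorphic
   sibling cherries are forbidden.  With k+1 colors there are only k types of cherry,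
   so for n >= 3 the subtrees of height 2 are all isomorphic; with k colors there is one
   type, which rules out n = 2.  Conversely, from k+1 pairwise distinct types at one
   level, omitting one type in turn gives k+1 distinct types at the next level; for
   n >= 3 the k+1 types of cherry are the cyclic intervals of length k-1 in Z/(k+1). *)

(** Addresses list the last step first, so the parent of [a :: s] is [s]. *)
Definition child (T : eqType) (s t : seq T) : bool :=
  if t is _ :: t' then t' == s else false.

(** The interface through which the later counting and coloring arguments see the tree; only words
    of length at most [n] stand for vertices. *)
Record addressing (G : sgraph) (k n : nat) (lab : seq 'I_k -> G)
    (adr : G -> seq 'I_k) : Prop := Addressing {
  adr_size : forall x, size (adr x) <= n;
  adrK : cancel adr lab;
  labK : forall s, size s <= n -> adr (lab s) = s;
  adjE : forall x y, adj x y = child (adr x) (adr y) || child (adr y) (adr x);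
  adr_root : forall f, automorphism f -> f (lab [::]) = lab [::]
}.

Lemma automorphism_adj (G : sgraph) (f : {perm G}) x y :
  automorphism f -> adj (f x) (f y) = adj x y.
Proof. by move=> /forallP/(_ x)/forallP/(_ y)/eqP. Qed.

Lemma automorphism_degree (G : sgraph) (f : {perm G}) x :
  automorphism f -> degree (f x) = degree x.
Proof.
move=> fA; rewrite /degree -[RHS](card_imset _ (@perm_inj _ f)); apply: eq_card => y.
rewrite inE; apply/idP/imsetP => [xy|[z]]; last first.
  by rewrite inE => xz ->; rewrite automorphism_adj.
exists ((f^-1)%g y); last by rewrite permKV.
by rewrite inE -(automorphism_adj _ _ fA) permKV.
Qed.

(** * Addresses of the vertices of a perfect tree *)

Section Structure.
Variables (G : sgraph) (k n : nat) (r : G).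
Hypotheses (hk : 1 < k) (hn : 0 < n) (Gconn : connected G).
Hypothesis (card_leaf : #|[set x : G | leaf x]| = k ^ n).
Hypotheses (deg_r : degree r = k) (dist_leaf : forall x, leaf x -> at_distance r x n).
Hypothesis deg_inner : forall x, ~~ leaf x -> x != r -> degree x = k.+1.

Definition nbrs (x : G) : {set G} := [set y | adj x y].

(** A state pairs the previous vertex with the current one. If there is no neighbour number [a], the
    walk stays put. *)
Definition step (q : G * G) (a : 'I_k) : G * G :=
  (q.2, nth q.2 (enum (nbrs q.2 :\ q.1)) a).

(** Starting from [(r, r)] removes no neighbour of the root, as [adj] is irreflexive. *)
Definition trace (s : seq 'I_k) : G * G := foldr (fun a q => step q a) (r, r) s.
Definition lab_of s := (trace s).2.
(* Junk value at the root: [par_of [::] = r]. *)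
Definition par_of s := (trace s).1.

Lemma par_cons a s : par_of (a :: s) = lab_of s. Proof. by []. Qed.

Lemma lab_cons_adj a s :
  lab_of (a :: s) = lab_of s \/ adj (lab_of s) (lab_of (a :: s)) /\ lab_of (a :: s) != par_of s.
Proof.
rewrite /lab_of /par_of /=; case: (trace s) => p x /=.
set e := enum _; have [ae|ae] := ltnP a (size e); last by left; rewrite nth_default.
by right; have := mem_nth x ae; rewrite mem_enum !inE => /andP[? ?].
Qed.

Lemma walk_trans (x y z : G) p q : walk_length x y p -> walk_length y z q ->
  walk_length x z (p + q).
Proof.
move=> [u [pu lu su]] [v [pv lv sv]]; exists (u ++ v).
by rewrite cat_path pu lu pv last_cat lu lv size_cat su sv.
Qed.

Lemma walk_adj (x y : G) : adj x y -> walk_length x y 1.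
Proof. by move=> xy; exists [:: y]; rewrite /= xy. Qed.

Lemma walk_lab_cat w s : exists2 m, m <= size w & walk_length (lab_of s) (lab_of (w ++ s)) m.
Proof.
elim: w => [|a w [m mw W]]; first by exists 0 => //; exists [::].
case: (lab_cons_adj a (w ++ s)) => [E|[E _]].
  by exists m; [exact: leqW | rewrite /= E].
by exists m.+1 => //; rewrite -addn1; apply: walk_trans W _; apply: walk_adj.
Qed.

Lemma walk_lab s : exists2 m, m <= size s & walk_length r (lab_of s) m.
Proof. by have := walk_lab_cat s [::]; rewrite cats0. Qed.

Lemma leaf_dist (x : G) m : leaf x -> walk_length r x m -> n <= m.
Proof. by move/dist_leaf => [_ H]; exact: H. Qed.

Lemma inner_lab s : size s < n -> ~~ leaf (lab_of s).
Proof.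
move=> sn; apply/negP => lx; have [m ms W] := walk_lab s.
by have := leaf_dist lx W; lia.
Qed.

(** Once the parent is removed, an inner vertex has at most [k] neighbours, so ['I_k] indexes them
    all. The adjacency hypothesis excludes a last step that stayed put. *)
Lemma lab_children s y : size s < n -> (s != [::] -> adj (par_of s) (lab_of s)) ->
  adj (lab_of s) y -> y != par_of s -> exists a, y = lab_of (a :: s).
Proof.
move=> sn sV sy yp; set e := enum (nbrs (lab_of s) :\ par_of s).
have ye : y \in e by rewrite mem_enum !inE yp sy.
have ek : size e <= k.
  rewrite -cardE; case: (eqVneq s [::]) => [->|s0].
    by rewrite -[X in _ <= X]deg_r; apply: subset_leq_card; apply: subsetDl.
  have := cardsD1 (par_of s) (nbrs (lab_of s)).
  have -> : par_of s \in nbrs (lab_of s) by rewrite inE adj_sym sV.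
  suff : degree (lab_of s) <= k.+1 by rewrite /degree -/(nbrs _); lia.
  have [->|/deg_inner->//] := eqVneq (lab_of s) r; first by rewrite deg_r.
  exact: inner_lab.
have ik : index y e < k by apply: leq_trans ek; rewrite index_mem.
by exists (Ordinal ik); rewrite /lab_of /= nth_index.
Qed.

(** A geodesic never turns back to the parent, so each of its steps goes to an indexed child. *)
Lemma geodesic_lab m (y : G) : m <= n -> at_distance r y m ->
  exists s, [/\ size s = m, lab_of s = y & s != [::] -> adj (par_of s) (lab_of s)].
Proof.
elim: m y => [|m IH] y mn [[p [rp lp sp]] ymin].
  by exists [::]; split => //; case: p sp lp {rp}.
case/lastP: p rp lp sp => // p z; rewrite rcons_path last_rcons size_rcons.
move=> /andP[rp zy] zE [sp]; subst z; set z := last r p in zy.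
have zm : at_distance r z m.
  split; first by exists p.
  move=> m' W; have := ymin (m' + 1) (walk_trans W (walk_adj zy)); lia.
have [s [ss sz sV]] := IH _ (ltnW mn) zm.
have yp : y != par_of s.
  apply/eqP => yE; case: s ss sz sV yE => [|a s] ss sz sV yE.
    by suff : m.+1 <= 0 by []; apply: ymin; rewrite yE; exists [::].
  have [m' m's] := walk_lab s; rewrite -(par_cons a) -yE => /ymin; move: ss => /=; lia.
have [||a yE] := lab_children _ sV _ yp; [by rewrite ss | by rewrite sz |].
by exists (a :: s); split; rewrite ?yE /= ?ss // => _; rewrite par_cons -yE sz.
Qed.

(* There are [k ^ n] leaves and each is reached by an address of length [n], so
   these addresses are exactly the leaves; this makes acyclicity redundant. *)
Lemma lab_tuples : [set lab_of t | t : n.-tuple 'I_k] = [set x | leaf x] /\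
  injective (fun t : n.-tuple 'I_k => lab_of t).
Proof.
have sub : [set x | leaf x] \subset [set lab_of t | t : n.-tuple 'I_k].
  apply/subsetP => x; rewrite inE => /dist_leaf/(geodesic_lab (leqnn n))[s [ss <- _]].
  by apply/imsetP; exists (Tuple (introT eqP ss)).
have le := leq_imset_card (fun t : n.-tuple 'I_k => lab_of t) predT.
rewrite card_tuple card_ord in le.
have E : [set x | leaf x] = [set lab_of t | t : n.-tuple 'I_k].
  by apply/eqP; rewrite eqEcard sub card_leaf.
have /imset_injP inj : #|[set lab_of t | t : n.-tuple 'I_k]| == #|{: n.-tuple 'I_k}|.
  by rewrite -E card_leaf card_tuple card_ord.
by split=> // t t'; apply: inj.
Qed.

Lemma leaf_lab s : size s = n -> leaf (lab_of s).
Proof.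
move=> sn; have [E _] := lab_tuples.
have : lab_of s \in [set lab_of t | t : n.-tuple 'I_k].
  by apply/imsetP; exists (Tuple (introT eqP sn)).
by rewrite E inE.
Qed.

Let pad m := nseq m (Ordinal (ltnW hk)).

(** Padding [s] to length [n] ends at a leaf, at distance [n] from [r]; a shortcut to [lab_of s]
    would shorten that distance. *)
Lemma lab_dist s m : size s <= n -> walk_length r (lab_of s) m -> size s <= m.
Proof.
move=> sn W; have [m' m'le W'] := walk_lab_cat (pad (n - size s)) s.
rewrite size_nseq in m'le.
have := leaf_dist (leaf_lab _) (walk_trans W W'); rewrite size_cat size_nseq.
by move=> /(_ (subnK sn)); lia.
Qed.

Lemma lab_adj a s : size s < n -> adj (lab_of s) (lab_of (a :: s)).
Proof.
move=> sn; case: (lab_cons_adj a s) => [E|[]//].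
have [m ms W] := walk_lab s; rewrite -E in W.
by have := @lab_dist (a :: s) _ sn W; rewrite /=; lia.
Qed.

Lemma lab_size s t : size s <= n -> size t <= n -> lab_of s = lab_of t ->
  size s = size t.
Proof.
move=> sn tn E; have [m ms W] := walk_lab s; have [m' mt W'] := walk_lab t.
rewrite E in W; rewrite -E in W'.
by have := lab_dist tn W; have := lab_dist sn W'; lia.
Qed.

Lemma adj_par s : 0 < size s <= n -> adj (par_of s) (lab_of s).
Proof. by case: s => // a s /= sn; apply: lab_adj. Qed.

Lemma adj_lab s y : size s <= n -> adj (lab_of s) y ->
  (s != [::] /\ y = par_of s) \/ (size s < n /\ exists a, y = lab_of (a :: s)).
Proof.
move=> sn sy; have [yp|yp] := eqVneq y (par_of s).
  left; split=> //; apply: contraTneq sy => s0; rewrite yp s0.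
  by rewrite (adj_irr (s := G)).
have [slt|] := ltnP (size s) n.
  right; split=> //; apply: lab_children => // s0; apply: adj_par.
  by rewrite lt0n size_eq0 s0 sn.
move=> ns; have {ns}sn' : size s = n by apply/eqP; rewrite eqn_leq sn.
have /cards1P[z Z] := leaf_lab sn'.
have : y \in [set z] by rewrite -Z inE.
have : par_of s \in [set z] by rewrite -Z inE adj_sym adj_par // sn' hn leqnn.
by rewrite !inE => /eqP pz /eqP yz; rewrite yz pz eqxx in yp.
Qed.

(** Equal labels have equal parents, since otherwise one parent would also be a child, of a
    different length. Hence the traces agree, and the same padding of both words leads to the same
    leaf, where addresses are unique. *)
Lemma lab_inj s t : size s <= n -> size t <= n -> lab_of s = lab_of t -> s = t.
Proof.
move=> sn tn E; have st := lab_size sn tn E.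
have T : trace s = trace t.
  have ET : par_of s = par_of t -> trace s = trace t.
    by move: E; rewrite /lab_of /par_of; case: trace => ? ?; case: trace => ? ? /= -> ->.
  apply: ET; case: s sn E st => [|a s] sn E; first by case: t {tn E}.
  case: t tn E => // b t tn E [st].
  have pt : adj (lab_of (a :: s)) (lab_of t) by rewrite E adj_sym; apply: lab_adj.
  case: (adj_lab sn pt) => [[_ tE]|[sn' [d dE]]]; first exact: esym tE.
  by have := lab_size (ltnW tn) (sn' : size (d :: a :: s) <= n) dE; rewrite /=; lia.
have [_ inj] := lab_tuples.
have sz u : size u = size s -> size (pad (n - size s) ++ u) == n.
  by move=> us; rewrite size_cat size_nseq us subnK.
have := inj (Tuple (sz s erefl)) (Tuple (sz t (esym st))).
rewrite /= /lab_of /trace !foldr_cat -!/(trace _) T => /(_ erefl)/(congr1 val)/= /eqP.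
by rewrite eqseq_cat // eqxx => /eqP.
Qed.

Lemma lab_surj x : exists s, (size s <= n) && (lab_of s == x).
Proof.
have /connectP[p] := Gconn r x.
suff H s : size s <= n -> path (@adj G) (lab_of s) p -> x = last (lab_of s) p ->
    exists s, (size s <= n) && (lab_of s == x) by exact: (H [::]).
elim: p s => [|y p IH] s sn /=; first by move=> _ ->; exists s; rewrite sn eqxx.
move=> /andP[sy yp] E; case: (adj_lab sn sy) => [[s0 yE]|[sn' [a yE]]].
  case: s sn s0 yE {sy} => // b s /= sn _ yE.
  by apply: (IH s); [apply: ltnW | rewrite -(par_cons b) -yE | rewrite -(par_cons b) -yE].
by apply: (IH (a :: s)); rewrite -?yE.
Qed.

Lemma addressing_exists : exists adr, addressing n lab_of adr.
Proof.
pose adr x := xchoose (lab_surj x).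
have adrP x : size (adr x) <= n /\ lab_of (adr x) = x.
  by have /andP[? /eqP ?] := xchooseP (lab_surj x).
exists adr; split.
- by move=> x; case: (adrP x).
- by move=> x; case: (adrP x).
- by move=> s sn; case: (adrP (lab_of s)) => an /lab_inj->.
- move=> x y; case: (adrP x) (adrP y); move: (adr x) (adr y) => s t sn <- [tn <-].
  apply/idP/orP => [st|[]].
  + case: (adj_lab sn st) => [[]|[sn' [a /lab_inj->//]]]; last by left => /=.
    case: s sn {st} => // a s sn _; rewrite par_cons => /lab_inj->//.
    - by right => /=.
    - exact: ltnW.
  + by case: t tn => // a t tn /= /eqP <-; apply: lab_adj.
  + by case: s sn => // a s sn /= /eqP <-; rewrite adj_sym; apply: lab_adj.
(* Only the root has degree [k]: every other vertex has degree [1] or [k.+1]. *)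
move=> f fA; apply/eqP; apply: contraT => fr.
have := automorphism_degree (lab_of [::]) fA; rewrite [RHS]deg_r.
have [/eqP ->|/deg_inner->//] := boolP (leaf (f (lab_of [::]))); lia.
Qed.

End Structure.

(** * Cyclic intervals modulo [M] *)

Lemma modn_lt_double m M : m < M + M -> m %% M = if m < M then m else m - M.
Proof.
move=> mM; case: ltnP => [/modn_small//|Mm].
by rewrite -{1}(subnK Mm) modnDr modn_small //; lia.
Qed.

Lemma modn_add_inj M t a b : 0 < a <= M -> 0 < b <= M ->
  (t + a) %% M = (t + b) %% M -> a = b.
Proof.
move=> aM bM /eqP; rewrite eqn_modDl !modn_lt_double; try lia.
by move=> /eqP; do 2 case: ifP; lia.
Qed.

Lemma cyclic_intervals_neq k M t t' : 1 < k -> k <= M <= k.+1 -> t < M -> t' < M -> t != t' ->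
  exists2 a, 0 < a < k & forall b, 0 < b < k -> (t + a) %% M != (t' + b) %% M.
Proof.
move=> k1 kM tM t'M tt'; pose a0 := if t < t' then t' - t else M + t' - t.
(* The interval after [t'] misses [t'] and, if [M = k.+1], also its predecessor. The chosen point is
   [t'] unless [a0 = k], when it is that predecessor. *)
exists (minn a0 k.-1); first by rewrite /a0; case: ifP; lia.
move=> b bk; apply/eqP; rewrite !modn_lt_double; try lia.
rewrite /a0; do 3 case: ifP; lia.
Qed.

(** * Isomorphism of colored subtrees *)

Section Similarity.
Variables (T : eqType) (k : nat) (c : seq 'I_k -> T).

(* The subtrees of height [h] hanging at [x] and [y] are isomorphic as colored
   rooted trees. *)
Fixpoint sim (h : nat) (x y : seq 'I_k) : bool :=
  (c x == c y) &&
  (if h is h'.+1 then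
     [exists p : {perm 'I_k}, [forall a, sim h' (a :: x) (p a :: y)]]
   else true).

Lemma sim_color h x y : sim h x y -> c x = c y.
Proof. by case: h => [|h] /= /andP[/eqP]. Qed.

Lemma simSP h x y : reflect
  (c x = c y /\ exists p : {perm 'I_k}, forall a, sim h (a :: x) (p a :: y))
  (sim h.+1 x y).
Proof.
apply: (iffP andP) => [[/eqP ? /existsP[p /forallP ?]]|[-> [p ?]]].
  by split=> //; exists p.
by split=> //; apply/existsP; exists p; apply/forallP.
Qed.

Lemma sim_refl h x : sim h x x.
Proof.
elim: h x => [|h IH] x; first by rewrite /= eqxx.
by apply/simSP; split=> //; exists 1%g => a; rewrite perm1.
Qed.

Lemma sim_sym h x y : sim h x y -> sim h y x.
Proof.
elim: h x y => [|h IH] x y; first by rewrite /= eq_sym.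
move/simSP => [xy [p H]]; apply/simSP; split=> //; exists (p^-1)%g => a.
by apply: IH; have := H ((p^-1)%g a); rewrite permKV.
Qed.

Lemma sim_trans h x y z : sim h x y -> sim h y z -> sim h x z.
Proof.
elim: h x y z => [|h IH] x y z; first by rewrite /= !andbT => /eqP->.
move=> /simSP[xy [p H]] /simSP[yz [q K]]; apply/simSP.
by split; [rewrite xy | exists (p * q)%g => a; rewrite permM; apply: IH (H a) (K _)].
Qed.

(** The children of [x] being pairwise dissimilar, a choice of similar children of [y] is injective,
    hence a permutation. *)
Lemma sim_children h x y : c x = c y ->
  (forall a a', sim h (a :: x) (a' :: x) -> a = a') ->
  (forall a, exists b, sim h (a :: x) (b :: y)) -> sim h.+1 x y.
Proof.
move=> xy inj /fin_all_exists[f fP]; apply/simSP; split=> //.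
have fI : injective f.
  move=> a a' E; apply: inj; apply: sim_trans (fP a) _.
  by rewrite E; apply: sim_sym.
by exists (perm fI) => a; rewrite permE.
Qed.

End Similarity.

(** * Automorphisms assembled from local permutations *)

Section Portrait.
Variables (k : nat) (Q : seq 'I_k -> seq 'I_k -> {perm 'I_k}).

(** The portrait of a tree automorphism: [Q x y] acts on the children of [x], where [y] is the image
    of [x]. *)
Fixpoint portrait (x : seq 'I_k) : seq 'I_k :=
  if x is a :: x' then let y := portrait x' in Q x' y a :: y else [::].

Lemma size_portrait x : size (portrait x) = size x.
Proof. by elim: x => //= a x ->. Qed.

Lemma portrait_inj : injective portrait.
Proof.
by elim=> [|a x IH] [|b y] //= [E /IH xy]; move: E; rewrite xy => /perm_inj->.
Qed.

Lemma child_portrait x y : child (portrait x) (portrait y) = child x y.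
Proof. by case: y => //= b y; rewrite (inj_eq portrait_inj). Qed.

End Portrait.

(** * Swapping similar siblings *)

Section Addressing.
Variables (G : sgraph) (k n : nat) (lab : seq 'I_k -> G) (adr : G -> seq 'I_k).
Hypothesis (L : addressing n lab adr).

Lemma portrait_automorphism Q : exists2 f : {perm G}, automorphism f &
  forall s, size s <= n -> f (lab s) = lab (portrait Q s).
Proof.
have fI : injective (fun x => lab (portrait Q (adr x))).
  move=> x y /(congr1 adr); rewrite !(labK L) ?size_portrait ?(adr_size L) //.
  by move=> /portrait_inj/(can_inj (adrK L)).
exists (perm fI) => [|s sn]; last by rewrite permE (labK L).
apply/forallP => x; apply/forallP => y.
by rewrite !permE !(adjE L) !(labK L) ?size_portrait ?(adr_size L) // !child_portrait.
Qed.

Lemma sim_automorphism (T : eqType) (c : seq 'I_k -> T) s a b :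
  size s < n -> a != b -> sim c (n - (size s).+1) (a :: s) (b :: s) ->
  exists f : {perm G}, [/\ automorphism f, f != 1%g &
    forall x, size x <= n -> exists y, [/\ size y <= n, f (lab x) = lab y & c x = c y]].
Proof.
move=> sn ab S.
(* Swap at [s], identity below the other fixed vertices, and below a moved vertex a witness of its
   similarity to its image; [simQ] shows that such a witness exists. *)
pose Q x y : {perm 'I_k} := if x == s then tperm a b else if x == y then 1%g else
  odflt 1%g [pick p : {perm 'I_k} |
    [forall a, sim c (n - (size x).+1) (a :: x) (p a :: y)]].
have [f fA fE] := portrait_automorphism Q.
have low x : size x <= size s -> portrait Q x = x.
  elim: x => //= d x IH xs; rewrite IH 1?ltnW // /Q eqxx.
  by rewrite ifN ?perm1 //; apply: contraTneq xs => ->; rewrite ltnn.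
have simQ x : size x <= n -> sim c (n - size x) x (portrait Q x).
  elim: x => [|d x IH] xn /=; first exact: sim_refl.
  rewrite {1}/Q; case: eqVneq => [->|xs].
    rewrite low // permE /=; case: eqVneq => [->//|_].
    by case: eqVneq => [->|_]; [apply: sim_sym | apply: sim_refl].
  case: eqVneq => [<-|xy]; first by rewrite perm1; apply: sim_refl.
  case: pickP => [p /forallP//|/= np].
  have := IH (ltnW xn); rewrite -subSS subSn // => /simSP[_ [p pP]].
  by have /forallP[] := np p.
exists f; split=> // [|x xn].
  apply/eqP => f1; have := fE (a :: s) sn.
  rewrite f1 perm1 => /(congr1 adr); rewrite !(labK L) ?size_portrait //=.
  by rewrite low // /Q eqxx tpermL => -[/eqP]; rewrite (negPf ab).
exists (portrait Q x); rewrite size_portrait fE //; split=> //.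
exact: sim_color (simQ x xn).
Qed.

Lemma fixing_siblings (S : {set G}) s a b : fixing S -> size s < n ->
  (size s).+1 = n -> lab (a :: s) \notin S -> lab (b :: s) \notin S -> a = b.
Proof.
move=> /fixingP SF slt sn aS bS; apply/eqP; apply: contraT => ab.
(* With one color per element of [S] and [None] elsewhere, preserving colors means fixing [S]
   pointwise. *)
pose c x := if lab x \in S then Some x else None.
have [|f [fA f1 fE]] := sim_automorphism (c := c) slt ab.
  by rewrite sn subnn /= /c (negPf aS) (negPf bS).
case/eqP: f1; apply: SF => // x xS; rewrite -{1}(adrK L x).
have [y [yn -> ]] := fE _ (adr_size L x); rewrite /c (adrK L) xS.
by case: ifP => // _ [<-]; rewrite (adrK L).
Qed.

Lemma distinguishing_siblings d (c : {ffun G -> 'I_d}) s a b : distinguishing c ->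
  size s < n -> sim (c \o lab) (n - (size s).+1) (a :: s) (b :: s) -> a = b.
Proof.
move=> /distinguishingP cD sn S; apply/eqP; apply: contraT => ab.
have [f [fA f1 fE]] := sim_automorphism sn ab S.
case/eqP: f1; apply: cD => // x; have [y [_ fx /= xy]] := fE _ (adr_size L x).
by rewrite -{1}(adrK L x) fx -xy (adrK L).
Qed.

(** * Counting leaves over the cherries *)

Hypotheses (hk : 1 < k) (hn : 0 < n).

Let cherry_leaf (p : (n.-1).-tuple 'I_k * 'I_k) : G := lab (p.2 :: p.1).

Lemma cherry_leaf_inj : injective cherry_leaf.
Proof.
move=> [t a] [u b] /(congr1 adr); rewrite !(labK L) ?size_tuple ?prednK //.
by move=> [-> /= /val_inj->].
Qed.

Lemma cherry_size (s : seq 'I_k) : (size s).+1 = n -> exists t : (n.-1).-tuple 'I_k, s = t.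
Proof.
move=> sn; have st : size s == n.-1 by rewrite -sn.
by exists (Tuple st).
Qed.

Section Count.
Variable S : {set G}.
(** Shared by fixing sets and by complements of color classes of distinguishing colorings. *)
Hypothesis S_sib : forall s a b, (size s).+1 = n ->
  lab (a :: s) \notin S -> lab (b :: s) \notin S -> a = b.

Let P := [set p | cherry_leaf p \in S].
Let miss (t : (n.-1).-tuple 'I_k) := [set a | lab (a :: t) \notin S].

Lemma card_miss t : #|miss t| <= 1.
Proof.
apply/card_le1_eqP => a b; rewrite !inE => aS bS; apply: S_sib bS aS.
by rewrite size_tuple prednK.
Qed.

Lemma card_cherry_pairs : #|P| = \sum_(t : (n.-1).-tuple 'I_k) (k - #|miss t|).
Proof.
have -> : #|P| = \sum_(t : (n.-1).-tuple 'I_k) \sum_(a | (t, a) \in P) 1.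
  rewrite pair_big_dep -sum1_card /=; apply: eq_bigl => -[t a] /=.
  by rewrite !inE.
apply: eq_bigr => t _; rewrite sum1_card.
have -> : k - #|miss t| = #|~: miss t|.
  by have := cardsC (miss t); rewrite card_ord; lia.
rewrite -[LHS]cardsE; apply: eq_card => a; rewrite !inE negbK; exact: (in_set _ (t, a)).
Qed.

Lemma leq_subn_miss t : k.-1 <= k - #|miss t|.
Proof. by have := card_miss t; lia. Qed.

Lemma cherry_pairs_le : #|P| <= #|S|.
Proof.
rewrite -(card_imset _ cherry_leaf_inj); apply: subset_leq_card.
by apply/subsetP => x /imsetP[p]; rewrite inE => pS ->.
Qed.

Lemma sum_cherries m : \sum_(t : (n.-1).-tuple 'I_k) m = k ^ n.-1 * m.
Proof. by rewrite sum_nat_const card_tuple card_ord. Qed.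

Lemma cherry_bound : k ^ n.-1 * k.-1 <= #|S|.
Proof.
apply: leq_trans cherry_pairs_le; rewrite card_cherry_pairs -sum_cherries.
by apply: leq_sum => t _; apply: leq_subn_miss.
Qed.

Hypothesis S_card : #|S| = k ^ n.-1 * k.-1.

(** In the equality case the leaves in [S] alone reach the bound, leaving no room for other
    vertices. *)
Lemma cherry_bound_leaf x : x \in S -> (size (adr x)) = n.
Proof.
have : cherry_leaf @: P == S.
  rewrite eqEcard (card_imset _ cherry_leaf_inj) S_card card_cherry_pairs -sum_cherries.
  apply/andP; split; first by apply/subsetP => y /imsetP[p]; rewrite inE => pS ->.
  by apply: leq_sum => t _; apply: leq_subn_miss.
move/eqP <- => /imsetP[[t a] _ ->].
by rewrite (labK L) /= size_tuple prednK.
Qed.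

(** A cherry with all its leaves in [S] would contribute [k] instead of [k.-1] and push the sum over
    the bound. *)
Lemma cherry_bound_miss s : (size s).+1 = n -> exists a, lab (a :: s) \notin S.
Proof.
move/cherry_size => [t ->]; have [t0|] := eqVneq (miss t) set0; last first.
  by case/set0Pn => a; rewrite inE; exists a.
have := cherry_pairs_le; rewrite card_cherry_pairs S_card -sum_cherries.
rewrite (bigD1 t) // [X in _ <= X](bigD1 t) //= t0 cards0 subn0.
set A := \sum_(_ | _) _; set B := \sum_(_ | _) _.
have : B <= A by apply: leq_sum => u _; apply: leq_subn_miss.
by move: A B => A B BA AB; exfalso; lia.
Qed.

End Count.

Lemma Fix_ge : k ^ n.-1 * k.-1 <= Fix G.
Proof.
have [S SF <-] := Fix_attained G; apply: cherry_bound => s a b sn.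
by apply: fixing_siblings => //; rewrite sn.
Qed.

(** * A frugal coloring *)

Lemma cherry_card_le (S : {set G}) : 
  (forall x, x \in S -> exists s a, [/\ (size s).+1 = n, nat_of_ord a != 0 & x = lab (a :: s)]) ->
  #|S| <= k ^ n.-1 * k.-1.
Proof.
move=> SP; pose o := Ordinal (ltnW hk).
have -> : k ^ n.-1 * k.-1 = #|cherry_leaf @: setX setT [set~ o]|.
  by rewrite (card_imset _ cherry_leaf_inj) cardsX cardsT card_tuple card_ord cardsC1 card_ord.
apply: subset_leq_card; apply/subsetP => x /SP[s [a [/cherry_size[t ->] a0 ->]]].
by apply/imsetP; exists (t, a); rewrite ?inE.
Qed.

(* The children of a vertex of type [t] get the [k] types other than [t] in [0 .. k]. *)
Fixpoint ty (x : seq 'I_k) : nat := if x is a :: x' then bump (ty x') a else k.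

Lemma ty_le x : ty x <= k.
Proof. by case: x => //= a x; have := ltn_ord a; rewrite /bump; case: leqP => /=; lia. Qed.

(** The number of nonnull colors: [k - 1], [k], [k + 1] for [n = 1], [n = 2], [n >= 3]. *)
Let M := k - 2 + minn n 3.

(** For [n = 2] the cherries hang from the root, whose type is [k], so [k] does not occur among
    their types. *)
Lemma ty_lt x : (size x).+1 = n -> 1 < n -> ty x < M.
Proof.
move=> xn n1; have := ty_le x; rewrite /M; case: (ltnP 2 n) => [|n2]; first lia.
have {}n2 : n = 2 by lia.
case: x xn => [|a [|b x]]; rewrite n2 //= => _ _.
by have := ltn_ord a; rewrite /bump; case: leqP => /=; lia.
Qed.

(** Child [0] of a cherry is its null leaf; the others take the cyclic interval
    [t + 1, ..., t + k - 1] modulo [M], where [t] is the type of the cherry, raised by one because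
    [0] is null. *)
Definition leaf_color (x : seq 'I_k) : nat :=
  if x is a :: x' then
    if ((size x').+1 == n) && (a != 0 :> nat) then ((ty x' + a) %% M).+1 else 0
  else 0.

Lemma leaf_color_lt x : leaf_color x < M.+1.
Proof.
case: x => //= a x; case: ifP => // _.
by rewrite ltnS ltn_pmod // /M; lia.
Qed.

Definition frugal_coloring : {ffun G -> 'I_M.+1} :=
  [ffun x => Ordinal (leaf_color_lt (adr x))].

(** * Rigidity of the frugal coloring *)

Section Rigid.
Variable f : {perm G}.
Hypotheses (fA : automorphism f) (fc : forall x, frugal_coloring (f x) = frugal_coloring x).

Let g x := adr (f (lab x)).

Lemma lab_g x : lab (g x) = f (lab x). Proof. exact: adrK L _. Qed.

Lemma g_inj x y : size x <= n -> size y <= n -> g x = g y -> x = y.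
Proof.
move=> xn yn /(congr1 lab); rewrite !lab_g => /perm_inj/(congr1 adr).
by rewrite !(labK L).
Qed.

Lemma g_root : g [::] = [::].
Proof. by rewrite /g (adr_root L fA) (labK L). Qed.

Lemma g_child x y : size x <= n -> size y <= n -> child x y ->
  child (g x) (g y) || child (g y) (g x).
Proof.
move=> xn yn xy; rewrite /g -(adjE L) automorphism_adj // (adjE L) !(labK L) //.
by rewrite xy.
Qed.

(** The image of [a :: x] is adjacent to [g x], and by injectivity it is not the image of the parent
    of [x]. *)
Lemma g_cons a x : size x < n -> exists b, g (a :: x) = b :: g x.
Proof.
have adj_g y b (yn : size y < n) := @g_child y (b :: y) (ltnW yn) yn (eqxx y).
elim: x a => [|a' x IH] a xn; have := adj_g _ a xn.
  by rewrite g_root; case: (g _) => //= b y; rewrite orbF => /eqP->; exists b.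
case/orP; first by case: (g (a :: _)) => //= b y /eqP->; exists b.
have [b ->] := IH a' (ltnW xn); rewrite /= => /eqP/g_inj E.
by have /(congr1 size) := E (ltnW (ltnW xn)) xn; rewrite /=; lia.
Qed.

Lemma size_g x : size x <= n -> size (g x) = size x.
Proof.
elim: x => [|a x IH] xn; first by rewrite g_root.
by have [b ->] := g_cons a xn; rewrite /= IH // ltnW.
Qed.

Lemma leaf_color_g x : size x <= n -> leaf_color (g x) = leaf_color x.
Proof.
by move=> xn; have /(congr1 val) := fc (lab x); rewrite !ffunE /= (labK L).
Qed.

(** Induction on the height [h] above the cherries: the colors of a cherry determine its interval,
    hence its type, and higher up the type of a vertex is the one that its children omit. *)
Lemma ty_g h x : size x + h.+1 = n -> ty (g x) = ty x.
Proof.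
elim: h x => [|h IH] x xn; apply/eqP; apply: contraT => tt'.
  have sx : size x < n by lia.
  have n1 : 1 < n.
    by case: x xn tt' {sx} => [|a x] /=; [rewrite g_root eqxx | lia].
  have xn' : (size x).+1 = n by lia.
  have kM : k <= M <= k.+1 by rewrite /M; lia.
  have gn : (size (g x)).+1 = n by rewrite size_g // ltnW.
  have [|a ak aP] := cyclic_intervals_neq hk kM (ty_lt xn' n1) (ty_lt gn n1).
    by rewrite eq_sym.
  have ak' : a < k by lia.
  have [b bE] := g_cons (Ordinal ak') sx.
  have := leaf_color_g (sx : size (Ordinal ak' :: x) <= n).
  rewrite bE /= gn xn' eqxx /= -!lt0n; case/andP: (ak) => -> _.
  case: ifP => // b0 [] /esym/eqP; rewrite (negPf (aP b _)) // ltn_ord andbT; lia.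
(* The child of [x] of type [ty (g x)] would go to a child of [g x] of that type, which [bump]
   excludes. *)
have ak : unbump (ty x) (ty (g x)) < k.
  by have := ty_le x; have := ty_le (g x); rewrite /unbump; case: ltnP => /=; lia.
have sx : size x < n by lia.
have := IH (Ordinal ak :: x); have [b ->] := g_cons (Ordinal ak) sx.
rewrite /= unbumpK ?inE // => /(_ _)/eqP; rewrite eq_sym (negPf (neq_bump _ _)).
by apply; lia.
Qed.

(** From the root downwards: siblings above the leaves are told apart by their types, sibling leaves
    by their colors. *)
Lemma g_id x : size x <= n -> g x = x.
Proof.
elim: x => [|a x IH] xn; first exact: g_root.
have [b bE] := g_cons a xn; have gx := IH (ltnW xn); rewrite bE gx; congr (_ :: _).
apply: val_inj; rewrite gx in bE; have [sx|] := ltnP (size (a :: x)) n.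
  have /= := @ty_g (n - (size x).+2) (a :: x); rewrite bE /= => E.
  by apply: (can_inj (bumpK (ty x))); apply: E; move: sx => /=; lia.
move=> nx; have xn' : (size x).+1 = n by apply/eqP; rewrite eqn_leq xn nx.
have := leaf_color_g xn; rewrite bE /= xn' eqxx /= -!lt0n.
have := ltn_ord a; have := ltn_ord b.
move=> bk ak; case: (posnP b) => [->|b0]; case: (posnP a) => [->|a0] //= [].
by apply: modn_add_inj; rewrite /M; lia.
Qed.

End Rigid.

Lemma frugal_coloring_distinguishing : distinguishing frugal_coloring.
Proof.
apply/distinguishingP => f fA fc; apply/permP => x.
rewrite perm1 -[in RHS](adrK L x) -(g_id fA fc (adr_size L x)) lab_g.
by rewrite (adrK L).
Qed.

Lemma frugal_coloring_cost : #|~: color_class frugal_coloring ord0| <= k ^ n.-1 * k.-1.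
Proof.
apply: cherry_card_le => // x; rewrite !inE ffunE -val_eqE /=.
rewrite -{2}(adrK L x); case: (adr x) => //= a s.
by case: ifP => // /andP[/eqP sn a0] _; exists s, a.
Qed.

(** * Lower bound on the number of colors *)

Section LowerBound.
Variables (d : nat) (c : {ffun G -> 'I_d}) (i : 'I_d).
Hypotheses (cD : distinguishing c) (c_cost : #|~: color_class c i| = k ^ n.-1 * k.-1).

Let cc := c \o lab.

Lemma notin_nonnull x : (lab x \notin ~: color_class c i) = (cc x == i).
Proof. by rewrite !inE negbK. Qed.

Lemma nonnull_siblings s a b : (size s).+1 = n ->
  lab (a :: s) \notin ~: color_class c i -> lab (b :: s) \notin ~: color_class c i -> a = b.
Proof.
rewrite !notin_nonnull => sn /eqP ai /eqP bi.
apply: (distinguishing_siblings cD (s := s)); rewrite sn // subnn /= andbT -/(cc _).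
by apply/eqP; rewrite -[LHS]/(cc _) -[RHS]/(cc _) ai bi.
Qed.

Lemma inner_null x : size x < n -> cc x = i.
Proof.
move=> xn; apply/eqP; rewrite -notin_nonnull; apply/negP => xS.
have := cherry_bound_leaf nonnull_siblings c_cost xS.
by rewrite (labK L) ?(ltnW xn) // => E; rewrite E ltnn in xn.
Qed.

Let colors s : {set 'I_d} := [set cc (a :: s) | a : 'I_k].

Lemma card_colors s : (size s).+1 = n -> #|colors s| = k.
Proof.
move=> sn; rewrite card_imset ?card_ord // => a b ab.
apply: (distinguishing_siblings cD (s := s)); rewrite sn // subnn /= andbT; exact/eqP.
Qed.

Lemma null_colors s : (size s).+1 = n -> i \in colors s.
Proof.
move=> sn; have [a] := cherry_bound_miss nonnull_siblings c_cost sn.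
by rewrite notin_nonnull => /eqP<-; apply: imset_f.
Qed.

Lemma colors_sim s t : (size s).+1 = n -> (size t).+1 = n -> colors s = colors t ->
  sim cc 1 s t.
Proof.
move=> sn tn E; apply: sim_children; first by rewrite !inner_null ?sn ?tn.
  by move=> a b S; apply: (distinguishing_siblings cD (s := s)); rewrite sn // subnn.
move=> a; have : cc (a :: s) \in colors t by rewrite -E; apply: imset_f.
by case/imsetP => b _ ab; exists b; rewrite /= ab eqxx.
Qed.

(** Types of cherries are recorded by the complements of their color sets, which lie in [family]:
    only the empty set if [d = k], and [k] singletons if [d = k.+1]. *)
Let missing s := ~: colors s.
Let family := [set A : {set 'I_d} | A \subset ~: [set i] & #|A| == d - k].

Lemma card_family : #|family| = 'C(d.-1, d - k).
Proof. by rewrite cards_draws cardsC1 card_ord. Qed.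

Lemma missing_family s : (size s).+1 = n -> missing s \in family.
Proof.
move=> sn; rewrite inE setCS sub1set null_colors //=.
have := cardsC (colors s); rewrite card_ord card_colors // => dE.
by rewrite -[X in _ == X - _]dE addKn.
Qed.

Lemma missing_inj u : (size u).+2 = n -> injective (fun a => missing (a :: u)).
Proof.
move=> un a b /setC_inj E; apply: (distinguishing_siblings cD (s := u)); first by rewrite -un.
by rewrite -un subSS subSnn; apply: colors_sim.
Qed.

(** Below [u] hang [k] cherries of distinct types. One type is too few since [1 < k], so [d = k.+1],
    and then all [k] types occur. *)
Lemma missing_image u : (size u).+2 = n -> d <= k.+1 ->
  d = k.+1 /\ [set missing (a :: u) | a : 'I_k] = family.
Proof.
move=> un dk; set I := [set _ | _ : _].
have IF : I \subset family by apply/subsetP => A /imsetP[a _ ->]; apply: missing_family.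
have Ik : #|I| = k by rewrite card_imset ?card_ord //; apply: missing_inj.
have kd : k <= d.
  rewrite -(@card_colors (Ordinal (ltnW hk) :: u)) // -[X in _ <= X]card_ord.
  exact: max_card.
have := subset_leq_card IF; rewrite Ik card_family.
move=> kC; have dE : d = k.+1.
  apply/eqP; rewrite eqn_leq dk ltn_neqAle kd andbT; apply/eqP => dE.
  by move: kC; rewrite -dE subnn bin0; lia.
split=> //; apply/eqP; rewrite eqEcard IF Ik card_family dE.
by rewrite subSnn bin1 leqnn.
Qed.

Lemma frugal_lower_bound : k - 2 + minn n 3 < d.
Proof.
rewrite ltnNge; apply/negP => dM.
pose o := Ordinal (ltnW hk); pose o1 := Ordinal hk.
have kd : k <= d.
  rewrite -(@card_colors (nseq n.-1 o)) ?size_nseq ?prednK // -[X in _ <= X]card_ord.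
  exact: max_card.
case: (ltnP 1 n) => [n1|n1]; last lia.
have [||dE _] := @missing_image (nseq n.-2 o); [by rewrite size_nseq; lia | by lia |].
have n3 : 2 < n by lia.
(* At [s], of height 3, the children [o] and [o1] both carry all [k] types of cherry, so their
   subtrees are isomorphic. *)
set s := nseq (n - 3) o; have sn : (size s).+3 = n by rewrite size_nseq; lia.
suff /(congr1 val) : o = o1 by [].
apply: (distinguishing_siblings cD (s := s)); first by lia.
have -> : n - (size s).+1 = 2 by lia.
have null a : cc (a :: s) = i by apply: inner_null => /=; lia.
apply: sim_children; first exact: etrans (null _) (esym (null _)).
  move=> a b S; apply: (distinguishing_siblings cD (s := o :: s)) => /=; first lia.
  by have -> : n - (size s).+2 = 1 by lia.
move=> a; have := @missing_family (a :: o :: s) sn.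
have [|_ <-] := @missing_image (o1 :: s) sn; first by rewrite dE.
by case/imsetP => b _ /setC_inj E; exists b; apply: colors_sim.
Qed.

End LowerBound.

Lemma Fdist_addressing : Fdist G = (k - 2 + minn n 3).+1.
Proof.
have cD := frugal_coloring_distinguishing.
have cost := leq_trans (paint_cost_le ord0 cD) frugal_coloring_cost.
(* The complement of a color class of a distinguishing coloring is a fixing set, so the same
   coloring bounds [Fix] from above. *)
have FG : Fix G = k ^ n.-1 * k.-1.
  apply/eqP; rewrite eqn_leq Fix_ge // andbT.
  exact: leq_trans (Fix_le_paint_cost G _) cost.
rewrite /Fdist; case: ex_minnP => d /andP[dD /eqP dF] dmin; apply/eqP.
rewrite eqn_leq dmin /=; last first.
  rewrite eqn_leq Fix_le_paint_cost FG cost !andbT.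
  by apply/Dist_leP; exists frugal_coloring.
have G0 : 0 < #|G| by apply/card_gt0P; exists (lab [::]).
have [c [i [c'D ci]]] := paint_cost_attained G0 dD.
by apply: (@frugal_lower_bound d c i c'D); rewrite ci dF FG.
Qed.

End Addressing.

Theorem theorem2 (k n : nat) (G : sgraph) (hk : 2 <= k) (hn : 1 <= n)
    (hG : perfect_tree G k n) :
  Fdist G = if n == 1 then k else if n == 2 then k.+1 else k.+2.
Proof.
have [Gconn _ card_leaf [r [deg_r dist_leaf deg_inner]]] := hG.
have [adr L] := addressing_exists hk hn Gconn card_leaf deg_r dist_leaf deg_inner.
rewrite (Fdist_addressing L) //; case: eqP => n1; [lia | case: eqP; lia].
Qed.
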